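(* Fix a constant $c<1/2$. Let $\alpha,\beta>0$ satisfy $\alpha+\beta<c$, and let $\epsilon>0$ and $\delta\in[0,1)$. Assume that each $k^j$ is translation invariant on $\mathbb R^{p_j}$, i.e. there is a function $\kappa^j$ with $k^j(x,x')=\kappa^j(x-x')$ for all $x,x'\in\mathbb R^{p_j}$, $j\in[d]$. Moreover, assume that there exist positive constants $\eta^j$ such that $\kappa^j(0)-\kappa^j(x_0^j)\ge\eta^j$ for some $x_0^j\in\mathbb R^{p_j}$, $j\in[d]$. Then the minimax separation over $\mathcal P_{\mathrm{dHSIC}_{\mathbf k}}(\rho)$ is lower bounded as $$\rho^*_{\mathrm{dHSIC}}(\alpha,\beta,\epsilon,\delta,n)\ge C_\eta\max\Big\{\min\Big\{\sqrt{\frac{\log(1/(\alpha+\beta))}{n}},1\Big\},\ \min\Big\{\frac1{n\,\xi_{\epsilon,\delta}},1\Big\}\Big\},$$ where, for the fixed $c$, $C_\eta$ is a positive constant that only depends on $\eta^j$ for $j\in[d]$.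
   Context: Superscripts $j\in[d]=\{1,\dots,d\}$ are indices, not exponents; $d\ge2$ is fixed. For each $j$, $k^j:\mathbb R^{p_j}\times\mathbb R^{p_j}\to\mathbb R$ is a continuous, bounded, positive semi-definite kernel with RKHS $\mathcal H^j$. The tensor product kernel $\mathbf k((x^j)_j,(x'^j)_j)=\prod_{j}k^j(x^j,x'^j)$, with RKHS $\mathcal H_{\mathbf k}=\mathcal H^1\otimes\dots\otimes\mathcal H^d$ and unit ball $\mathcal F_{\mathbf k}$, is assumed characteristic. $\xi_{\epsilon,\delta}=\epsilon+\log(1/(1-\delta))$. For a distribution $P=P_{X^1,\dots,X^d}$ on $\mathbb R^{p_1}\times\dots\times\mathbb R^{p_d}$ with marginals $P_{X^j}$, $$\mathrm{dHSIC}_{\mathbf k}(P)=\sup_{f\in\mathcal F_{\mathbf k}}\{\mathbb E_{P}[f(X^1,\dots,X^d)]-\mathbb E_{\otimes_jP_{X^j}}[f(X^1,\dots,X^d)]\}.$$ $\mathcal P_{\mathrm{dHSIC}_{\mathbf k}}(\rho)$ is the set of distributions $P$ on $\mathbb R^{p_1}\times\dots\times\mathbb R^{p_d}$ with $\mathrm{dHSIC}_{\mathbf k}(P)\ge\rho$; $\mathcal P_0$ is the set of those with $P=\otimes_jP_{X^j}$. A test $\phi$ is a (possibly randomized) $\{0,1\}$-valued function of an i.i.d. sample $\mathcal X_n$ of size $n$ from $P$; $\mathbb E_P$ is over the sample and the randomization. It is $(\epsilon,\delta)$-DP if for all output sets $S\subseteq\{0,1\}$ and all datasets $\mathcal X_n,\tilde{\mathcal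 X}_n$ of size $n$ differing in at most one observation, $\mathbb P(\phi(\mathcal X_n)\in S\mid\mathcal X_n)\le e^\epsilon\,\mathbb P(\phi(\tilde{\mathcal X}_n)\in S\mid\tilde{\mathcal X}_n)+\delta$ (for tests with an auxiliary variable independent of the data, this is required conditionally on each of its values). Let $$\Phi_{\alpha,\epsilon,\delta}=\Big\{\phi:\sup_{P\in\mathcal P_0}\mathbb E_P[\phi]\le\alpha\text{ and }\phi\text{ is }(\epsilon,\delta)\text{-DP}\Big\},$$ $$\rho^*_{\mathrm{dHSIC}}(\alpha,\beta,\epsilon,\delta,n)=\inf\Big\{\rho>0:\inf_{\phi\in\Phi_{\alpha,\epsilon,\delta}}\sup_{P\in\mathcal P_{\mathrm{dHSIC}_{\mathbf k}}(\rho)}\mathbb E_P[1-\phi]\le\beta\Big\}$$ (a supremum over an empty class is read as $0$). *)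

(* Defs.v *)
From HB Require Import structures.
From mathcomp Require Import all_boot all_order all_algebra.
From mathcomp Require Import all_classical all_reals all_analysis.

Set Implicit Arguments.
Unset Strict Implicit.
Unset Printing Implicit Defensive.
Import Order.TTheory GRing.Theory Num.Theory numFieldNormedType.Exports.
Local Open Scope classical_set_scope.
Local Open Scope ring_scope.

Definition borel_mx_display : measure_display.
Proof. exact: default_measure_display. Qed.

Section borel_mx.
Context (R : realType) (m n : nat).

Definition borel_mx : set (set 'M[R]_(m, n)) := <<s open >>.

Let borel_mx0 : borel_mx set0. Proof. exact: sigma_algebra0. Qed.

Let borel_mxC A : borel_mx A -> borel_mx (~` A).
Proof. exact: sigma_algebraC. Qed.

Let borel_mx_bigcup (F : (set 'M[R]_(m, n))^nat) :
  (forall i, borel_mx (F i)) -> borel_mx (\bigcup_i F i).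
Proof. exact: sigma_algebra_bigcup. Qed.

HB.instance Definition _ := @isMeasurable.Build borel_mx_display
  'M[R]_(m, n) borel_mx borel_mx0 borel_mxC borel_mx_bigcup.

End borel_mx.

(* Dependent finite products with the product sigma-algebra; also used, with a
   constant family, for samples. *)
Definition dprod_display : measure_display -> measure_display.
Proof. exact. Qed.

Definition dprod (I : finType) d (T : I -> measurableType d) : Type :=
  forall i, T i.

Section dprod_measurable.
Context (I : finType) d (T : I -> measurableType d).

Definition dproj (i : I) (x : dprod T) : T i := x i.

Definition dprod_sigma : set (set (dprod T)) :=
  <<s \bigcup_(i in [set: I]) preimage_set_system setT (dproj i) measurable >>.

HB.instance Definition _ := Pointed.copy (dprod T) (forall i, T i).

Let dprod_sigma0 : dprod_sigma set0. Proof. exact: sigma_algebra0. Qed.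

Let dprod_sigmaC A : dprod_sigma A -> dprod_sigma (~` A).
Proof. exact: sigma_algebraC. Qed.

Let dprod_sigma_bigcup (F : (set (dprod T))^nat) :
  (forall i, dprod_sigma (F i)) -> dprod_sigma (\bigcup_i F i).
Proof. exact: sigma_algebra_bigcup. Qed.

HB.instance Definition _ := @isMeasurable.Build (dprod_display d)
  (dprod T) dprod_sigma dprod_sigma0 dprod_sigmaC dprod_sigma_bigcup.

Lemma measurable_dproj i : measurable_fun [set: dprod T] (dproj i).
Proof.
move=> _ Y mY; rewrite setTI; apply: sub_sigma_algebra.
by exists i => //; exists Y => //; rewrite setTI.
Qed.

HB.instance Definition _ i := @isMeasurableFun.Build _ _ _ _ (dproj i)
  (@measurable_dproj i).

Lemma measurable_fun_dprod d' (U : measurableType d') (f : U -> dprod T) :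
  (forall i, measurable_fun [set: U] (dproj i \o f)) ->
  measurable_fun [set: U] f.
Proof.
move=> mf _ Y mY; rewrite setTI.
suff : dprod_sigma `<=` [set A | measurable (f @^-1` A)] by exact.
apply: smallest_sub => [|A [i _ [B mB <-]]]; last first.
  by rewrite /= setTI -[X in measurable X]setTI; exact: mf.
split=> /= [|A mA|F mF]; first by rewrite preimage_set0.
- by rewrite setTD preimage_setC; exact: measurableC.
- by rewrite preimage_bigcup; exact: bigcupT_measurable.
Qed.

Definition rect (A : forall i, set (T i)) : set (dprod T) :=
  [set x | forall i, A i (x i)].

End dprod_measurable.

Section product_probability.
Context (R : realType) (I : finType) d (T : I -> measurableType d).
Local Open Scope ereal_scope.

Let upd (i : I) (z : T i * dprod T) : dprod T := eqtype.dfwith z.2 z.1.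

Let measurable_upd i : measurable_fun [set: T i * dprod T] (@upd i).
Proof.
apply: measurable_fun_dprod => j.
have [<-|ij] := eqVneq i j.
  rewrite (_ : _ \o _ = fst)//; apply/funext => z.
  by rewrite /= /dproj /upd eqtype.dfwith_in.
rewrite (_ : _ \o _ = dproj j \o snd); last first.
  by apply/funext => z; rewrite /= /dproj /upd eqtype.dfwith_out.
by apply: measurableT_comp => //; exact: measurable_dproj.
Qed.

Lemma measurable_rect (A : forall i, set (T i)) :
  (forall i, measurable (A i)) -> measurable (rect A).
Proof.
move=> mA; rewrite (_ : rect A = \bigcap_(i in [set: I]) (dproj i @^-1` A i)).
  apply: fin_bigcap_measurable => [|i _]; first exact: finite_finset.
  by rewrite -[X in measurable X]setTI; exact: (@measurable_dproj _ _ T i measurableT _ (mA i)).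
by apply/seteqP; split=> [x H i _|x H i]; [exact: H|exact: (H i)].
Qed.

Lemma product_probability_exists (P : forall i, probability (T i) R) :
  exists Q : probability (dprod T) R,
    forall A : forall i, set (T i), (forall i, measurable (A i)) ->
    Q (rect A) = \prod_(i in I) P i (A i).
Proof.
suff H (s : seq I) : uniq s -> exists Q : probability (dprod T) R,
    forall A : forall i, set (T i), (forall i, measurable (A i)) ->
    Q (rect A) = \prod_(i in I)
      (if i \in s then P i (A i) else \d_(point : T i) (A i)).
  have [Q HQ] := H (enum I) (enum_uniq I); exists Q => A mA.
  by rewrite HQ//; apply: eq_bigr => i _; rewrite mem_enum.
elim: s => [_|i s IH /= /andP[si us]].
  exists (\d_(point : dprod T)) => A mA.
  rewrite /= diracE; have [|] := boolP (point \in rect A).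
    rewrite inE => H; rewrite big1// => i _.
    by rewrite diracE mem_set//; exact: H.
  rewrite notin_setE => /existsNP[i Hi].
  by rewrite (bigD1 i)//= diracE memNset// mul0e.
have [Q HQ] := IH us.
pose f : {mfun (T i * dprod T)%type >-> dprod T} :=
  HB.pack (@upd i) (isMeasurableFun.Build _ _ _ _ (@upd i) (@measurable_upd i)).
exists (distribution (P i \x Q) f) => A mA.
pose B j : set (T j) := if j == i then setT else A j.
have mB j : measurable (B j) by rewrite /B; case: ifP => // _; exact: mA.
have fA : f @^-1` rect A = A i `*` rect B.
  apply/seteqP; split => -[x y] /=.
    move=> H; split=> [|j]; first by have := H i; rewrite /upd eqtype.dfwith_in.
    have := H j; rewrite /upd /B /=; have [->|ij] := eqVneq j i; first by [].
    by rewrite eqtype.dfwith_out// eq_sym.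
  move=> [Ax By] j; rewrite /upd /=; case: eqtype.dfwithP => // k ik.
  by have := By k; rewrite /B eq_sym (negbTE ik).
transitivity ((P i \x Q) (A i `*` rect B)); first by rewrite -fA.
transitivity (P i (A i) * Q (rect B)).
  by apply: product_measure1E; [exact: mA|exact: measurable_rect].
rewrite HQ// (bigD1 i)//= (negbTE si) /B eqxx diracT mul1e.
rewrite [RHS](bigD1 i)//= inE eqxx/=; congr (_ * _).
by apply: eq_bigr => j ji; rewrite inE (negbTE ji).
Qed.

Definition product_probability (P : forall i, probability (T i) R) :
  probability (dprod T) R := sval (cid (product_probability_exists P)).

Lemma product_probabilityE (P : forall i, probability (T i) R)
    (A : forall i, set (T i)) : (forall i, measurable (A i)) ->
  product_probability P (rect A) = \prod_(i in I) P i (A i).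
Proof. by move=> mA; rewrite /product_probability; case: cid => Q /= ->. Qed.

Lemma product_probability_unique (P : forall i, probability (T i) R)
    (Q : probability (dprod T) R) :
  (forall A : forall i, set (T i), (forall i, measurable (A i)) ->
    Q (rect A) = \prod_(i in I) P i (A i)) ->
  forall X, measurable X -> Q X = product_probability P X.
Proof.
move=> HQ; apply: (@measure_unique _ R (dprod T)
  [set X | exists2 A : forall i, set (T i),
     (forall i, measurable (A i)) & X = rect A] (fun=> setT)).
- apply/seteqP; split; last first.
    apply: smallest_sub; first exact: sigma_algebra_measurable.
    by move=> X [A mA ->]; exact: measurable_rect.
  apply: smallest_sub; first exact: smallest_sigma_algebra.
  move=> X [i _ [B mB <-]]; apply: sub_sigma_algebra.
  exists (eqtype.dfwith (fun j => [set: T j]) B) => [j|].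
    by case: eqtype.dfwithP.
  rewrite setTI; apply/seteqP; split=> [x Bx j|x /(_ i)].
    by case: eqtype.dfwithP.
  by rewrite eqtype.dfwith_in.
- move=> X Y [A mA ->] [B mB ->]; exists (fun i => A i `&` B i).
    by move=> i; exact: measurableI.
  by apply/seteqP; split=> [x [Ax Bx] i|x AB]; [|split=> i; case: (AB i)].
- by move=> _; exists (fun=> setT) => //; apply/seteqP; split.
- by apply/seteqP; split=> // x _; exists 0%N.
- by move=> X [A mA ->]; rewrite [RHS]product_probabilityE//; exact: HQ.
- move=> _; apply: (@le_lt_trans _ _ 1); last exact: ltry.
  exact: probability_le1.
Qed.

End product_probability.

Section rkhs.
Context (R : realType) (T : Type).

Definition psd_kernel (k : T -> T -> R) : Prop :=
  (forall x y, k x y = k y x) /\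
  (forall (m : nat) (x : 'I_m -> T) (a : 'I_m -> R),
    0 <= \sum_(i < m) \sum_(j < m) a i * a j * k (x i) (x j)).

Definition bounded_kernel (k : T -> T -> R) : Prop :=
  exists M : R, forall x y, `|k x y| <= M.

(* A Hilbert space of real functions on T, given as a linear subspace
   [fh_mem] of T -> R; [fh_ip] is only meaningful on that subspace. *)
Record function_hilbert := FunctionHilbert {
  fh_mem : set (T -> R) ;
  fh_ip : (T -> R) -> (T -> R) -> R ;
  fh_norm := fun f => Num.sqrt (fh_ip f f) ;
  fh_mem0 : fh_mem 0 ;
  fh_memD : forall (a : R) f g, fh_mem f -> fh_mem g -> fh_mem (a *: f + g) ;
  fh_ipC : forall f g, fh_mem f -> fh_mem g -> fh_ip f g = fh_ip g f ;
  fh_ip_linear : forall (a : R) f g h, fh_mem f -> fh_mem g -> fh_mem h ->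
    fh_ip (a *: f + g) h = a * fh_ip f h + fh_ip g h ;
  fh_ip_ge0 : forall f, fh_mem f -> 0 <= fh_ip f f ;
  fh_ip_eq0 : forall f, fh_mem f -> fh_ip f f = 0 -> f = 0 ;
  fh_complete : forall u : nat -> T -> R, (forall n, fh_mem (u n)) ->
    (forall e : R, 0 < e -> exists N, forall m n, (N <= m)%N -> (N <= n)%N ->
      fh_norm (u m - u n) < e) ->
    exists2 f, fh_mem f & (fun n => fh_norm (u n - f)) @ \oo --> (0 : R) }.

(* By Moore-Aronszajn, such an H exists for every psd kernel k and is unique, up
   to the values of [fh_ip] outside [fh_mem]. *)
Definition is_rkhs (k : T -> T -> R) (H : function_hilbert) : Prop :=
  (forall x, fh_mem H (k^~ x)) /\
  (forall f x, fh_mem H f -> fh_ip H f (k^~ x) = f x).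

Definition unit_ball (H : function_hilbert) : set (T -> R) :=
  [set f | fh_mem H f /\ fh_norm H f <= 1].

End rkhs.

(* By the reproducing property, the mean embedding of P, as an element of the
   RKHS of k, is the function y |-> E_P[k(X, y)]. *)
Definition mean_embedding (R : realType) d (T : measurableType d)
    (k : T -> T -> R) (P : probability T R) : T -> \bar R :=
  fun y => 'E_P[k^~ y]%E.

Definition characteristic (R : realType) d (T : measurableType d)
    (k : T -> T -> R) : Prop :=
  forall P Q : probability T R, mean_embedding k P = mean_embedding k Q ->
  forall A, measurable A -> P A = Q A.

Section dhsic.
Context (R : realType) (d : nat) (p : 'I_d -> nat).

Definition joint : measurableType (dprod_display borel_mx_display) :=
  dprod (fun j : 'I_d => 'rV[R]_(p j)).

Definition tensor_kernel (k : forall j, 'rV[R]_(p j) -> 'rV[R]_(p j) -> R)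
    (x x' : joint) : R := \prod_(j < d) k j (x j) (x' j).

Definition marginal (P : probability joint R) (j : 'I_d) :
  probability 'rV[R]_(p j) R := distribution P (dproj j).

Definition product_of_marginals (P : probability joint R) :
  probability joint R := product_probability (marginal P).

Definition independent_coords : set (probability joint R) :=
  [set P : probability joint R | forall A, measurable A ->
    P A = product_of_marginals P A].

Definition dHSIC (H : function_hilbert R joint) (P : probability joint R) :
    \bar R :=
  ereal_sup [set 'E_P[f] - 'E_(product_of_marginals P)[f] | f in unit_ball H]%E.

Definition dHSIC_alternatives (H : function_hilbert R joint) (rho : R) :
    set (probability joint R) :=
  [set P : probability joint R | (rho%:E <= dHSIC H P)%E].

End dhsic.

Section tests.
Context (R : realType) d (X : measurableType d) (n : nat).

Definition dataset : measurableType (dprod_display d) :=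
  dprod (fun _ : 'I_n => X).

Definition iid_law (P : probability X R) : probability dataset R :=
  product_probability (fun=> P).

Definition neighbours (x y : dataset) : Prop :=
  forall i j : 'I_n, x i <> y i -> x j <> y j -> i = j.

(* A randomized test: an auxiliary variable of law [aux_law], independent of
   the data, and the conditional law of the {0,1}-valued output given the data
   and the auxiliary variable. A test without auxiliary variable has
   [aux = unit]. *)
Record test := Test {
  aux_display : measure_display ;
  aux : measurableType aux_display ;
  aux_law : probability aux R ;
  output : R.-pker (dataset * aux)%type ~> bool }.

(* E_P[g(phi)], over the sample, the auxiliary variable and the remaining
   randomization *)
Definition test_expectation (P : probability X R) (phi : test)
    (g : bool -> R) : \bar R :=
  (\int[iid_law P]_x \int[aux_law phi]_u
    \int[output phi (x, u)]_b (g b)%:E)%E.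

Definition dp (eps delta : R) (phi : test) : Prop :=
  forall (S : set bool) (x y : dataset) (u : aux phi), neighbours x y ->
    (output phi (x, u) S
       <= (expR eps)%:E * output phi (y, u) S + delta%:E)%E.

Definition sup_or_0 (A : set (\bar R)) : \bar R :=
  if A == set0 then 0%E else ereal_sup A.

Definition level_dp_test (P0 : set (probability X R)) (alpha eps delta : R)
    (phi : test) : Prop :=
  (sup_or_0 [set test_expectation P phi (fun b => b%:R) | P in P0]
     <= alpha%:E)%E /\
  dp eps delta phi.

Definition minimax_type2 (P0 P1 : set (probability X R))
    (alpha eps delta : R) : \bar R :=
  ereal_inf [set e | exists2 phi : test, level_dp_test P0 alpha eps delta phi &
    e = sup_or_0 [set test_expectation P phi (fun b => 1 - b%:R) | P in P1]].

End tests.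

Definition rho_dHSIC (R : realType) (d : nat) (p : 'I_d -> nat)
    (H : function_hilbert R (joint R p)) (alpha beta eps delta : R) (n : nat) :
    \bar R :=
  ereal_inf [set rho%:E | rho in [set rho : R | 0 < rho /\
    (minimax_type2 n (@independent_coords R d p) (dHSIC_alternatives H rho)
       alpha eps delta <= beta%:E)%E]].

Definition xi (R : realType) (eps delta : R) : R :=
  eps + ln (1 / (1 - delta)).

(* Main.v *)
Require Import Defs.
From mathcomp Require Import all_boot all_order all_algebra.
From mathcomp Require Import all_classical all_reals all_analysis.
From mathcomp Require Import measurable_realfun ring lra.
Import Order.TTheory GRing.Theory Num.Theory numFieldNormedType.Exports.
Local Open Scope classical_set_scope.
Local Open Scope ring_scope.

Set Implicit Arguments.
Unset Strict Implicit.
Unset Printing Implicit Defensive.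

(** The proof is Le Cam's two-point method. Two coordinates [j0], [j1] are
    chosen and all the others are fixed at [0]. Along each of [j0], [j1] only
    the two values [0] and [x0 j] occur, where [x0 j] is a point at which
    [kappa j] has dropped by [eta j] or more. On these four [corner]s consider the law
    with weights [1/4 + t] when the two selected bits agree and [1/4 - t] when
    they differ. Its marginals do not depend on [t], so the law with [t = 0] is
    the product of the marginals of every other one
    ([product_of_marginals_corr]); it is the null hypothesis.

    The difference between the law at [t] and its product of marginals is [t]
    times a tensor product of differences of point masses. By the reproducing
    property dHSIC is at least the norm of its embedding ([dHSIC_atoms]), and
    for a product kernel the squared norm factors into
    [4 * t^2 * (kappa j0 0 - kappa j0 (x0 j0)) * (kappa j1 0 - kappa j1 (x0 j1))]
    times the product of [kappa j 0] over the other [j] ([corr_gram]). Positive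
    semi-definiteness gives [kappa j 0 >= eta j / 2], so dHSIC is at least
    [t * sqrt (gap_product eta j0 j1)] ([corr_dHSIC]).

    It remains to choose [t] as large as possible while every test has total
    error above [alpha + beta] ([separation_of_risk]). All laws are finite
    mixtures of point masses, so expectations under a sample are finite sums
    ([product_atoms]), and two bounds on the total error are available.

    - Without privacy ([risk_affinity]): the total error is at least half the
      square of the Hellinger affinity, which is multiplicative over the sample
      and at least [1 - 8 * t ^+ 2] for one observation ([corr_affinity]). So
      the error is at least [exp (- 32 n t^2) / 2]. Since [alpha + beta < c] with
      [c < 1/2] fixed, the factor [1/2] can be absorbed in the exponent
      ([exponent_slack_spec]), and [t^2] may be of order
      [log (1 / (alpha + beta)) / n].

    - With privacy ([risk_coupling]): the rejection probability of a private test
      changes by at most [xi eps delta] when one observation changes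
      ([ler_sub_dp]). The two laws are the images of one distribution under two
      maps that differ with probability at most [4 * t]
      ([coupling_disagreement]); the coupled samples are at expected Hamming
      distance at most [4 n t], so [t] may be of order [1 / (n * xi eps delta)]. *)

(** * Finite mixtures of point masses *)

Section finite_mixtures.
Context (R : realType) d (T : measurableType d) (V : finType).
Implicit Types (P : probability T R) (q : V -> R) (e : V -> T).

(** The points [e v] need not be distinct, so one law has many such
    representations; couplings are expressed by choosing a suitable one. *)
Definition has_atoms P q e :=
  forall A, measurable A -> P A = (\sum_v q v * \1_A (e v))%:E.

(** Adding one point mass at a time also yields the integration formula, because
    the integral is additive in the measure. *)
Lemma finite_mixture_measure q e (s : seq V) : (forall v, 0 <= q v) ->
  exists mu : measure T R,
    (forall A, measurable A -> mu A = (\sum_(v <- s) q v * \1_A (e v))%:E) /\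
    (forall f : T -> \bar R, measurable_fun [set: T] f -> (forall x, 0 <= f x)%E ->
       \int[mu]_x f x = \sum_(v <- s) (q v)%:E * f (e v))%E.
Proof.
move=> q0; elim: s => [|v s [mu [muE muI]]].
  exists mzero; split => [A _|f mf f0]; rewrite big_nil//.
  exact: integral_measure_zero.
exists (measure_add (mscale (NngNum (q0 v)) \d_(e v)) mu); split => [A mA|f mf f0].
  rewrite [LHS](measure_addE (mscale (NngNum (q0 v)) \d_(e v)) mu A).
  rewrite muE// big_cons EFinD EFinM.
  by congr (_ * _ + _)%E; rewrite diracE indicE.
rewrite ge0_integral_measure_add// ge0_integral_mscale//= integral_dirac//.
by rewrite diracT mul1e muI// big_cons.
Qed.

Lemma atoms_exist q e : (forall v, 0 <= q v) -> \sum_v q v = 1 ->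
  exists P, has_atoms P q e.
Proof.
move=> q0 q1; have [mu [muE _]] := finite_mixture_measure e (enum V) q0.
have muT : mu setT = 1%E.
  rewrite muE// big_enum/=; under eq_bigr do rewrite indicT mulr1.
  by rewrite q1.
(* [mu] already has mass one; normalizing it only changes its type. *)
exists (mnormalize mu \d_point) => A mA.
rewrite /= /mnormalize muT/= onee_eq0/= invr1 mule1.
by rewrite muE// big_enum.
Qed.

Lemma ge0_integral_atoms P q e (f : T -> \bar R) : (forall v, 0 <= q v) ->
  has_atoms P q e -> measurable_fun [set: T] f -> (forall x, 0 <= f x)%E ->
  (\int[P]_x f x = \sum_v (q v)%:E * f (e v))%E.
Proof.
move=> q0 Pqe mf f0; have [mu [muE muI]] := finite_mixture_measure e (enum V) q0.
rewrite (eq_measure_integral mu) => [|A mA _]; last first.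
  by apply: etrans (Pqe _ mA) _; rewrite muE// big_enum.
by rewrite muI// big_enum.
Qed.

Lemma expectation_atoms P q e (f : T -> R) : (forall v, 0 <= q v) ->
  has_atoms P q e -> measurable_fun [set: T] f ->
  ('E_P[f] = (\sum_v q v * f (e v))%:E)%E.
Proof.
move=> q0 Pqe mf; rewrite unlock integralE.
have mfE : measurable_fun setT (EFin \o f) by exact/measurable_EFinP.
rewrite !(ge0_integral_atoms q0 Pqe)//;
  [|exact: measurable_funeneg|exact: measurable_funepos].
under eq_bigr do rewrite funeposE/= -EFin_max -EFinM.
under [X in (_ - X)%E]eq_bigr do rewrite funenegE/= -EFin_max -EFinM.
rewrite !sumEFin -EFinB -sumrB; congr EFin; apply: eq_bigr => v _.
rewrite -mulrBr; congr (_ * _).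
case: (leP (f (e v)) 0) => h; case: leP; lra.
Qed.

End finite_mixtures.

(** The mixture over all choice functions [w] assigns the right mass to
    rectangles, by distributing the product over the sums, and a product law is
    determined by its values on rectangles. *)
Lemma product_atoms (R : realType) (I : finType) d (T : measurableType d)
    (V : finType) (P : I -> probability T R) (q : I -> V -> R) (e : I -> V -> T) :
  (forall i v, 0 <= q i v) -> (forall i, \sum_v q i v = 1) ->
  (forall i, has_atoms (P i) (q i) (e i)) ->
  has_atoms (product_probability P : probability (dprod (fun=> T)) R)
    (fun w : {ffun I -> V} => \prod_i q i (w i)) (fun w i => e i (w i)).
Proof.
move=> q0 q1 Pqe.
have w0 (w : {ffun I -> V}) : 0 <= \prod_i q i (w i) by exact: prodr_ge0.
have w1 : \sum_(w : {ffun I -> V}) \prod_i q i (w i) = 1.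
  by rewrite -bigA_distr_bigA/= big1.
have [Q HQ] := @atoms_exist R _ (dprod (fun _ : I => T)) _ _
  (fun (w : {ffun I -> V}) i => e i (w i)) w0 w1.
move=> A mA; rewrite -(product_probability_unique (Q := Q))//; first exact: HQ.
move=> B mB; rewrite HQ; last exact: measurable_rect.
under [RHS]eq_bigr do rewrite Pqe//.
rewrite prodEFin bigA_distr_bigA/=; congr EFin; apply: eq_bigr => w _.
rewrite big_split/=; congr (_ * _); rewrite indicE.
have [|] := boolP ((fun i => e i (w i)) \in rect B).
  by rewrite inE => h; rewrite big1// => i _; rewrite indicE mem_set//; exact: h.
rewrite notin_setE => /existsNP[i Hi].
by rewrite (bigD1 i)//= indicE memNset// mul0r.
Qed.

(** * Inequalities behind the two error bounds *)

(** With squared weights the left-hand side is half the squared Hellinger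
    affinity [S]. Pointwise, [2 * l * a * b] is at most the smaller of [a^2] and
    [b^2] plus [l^2] times the larger, and the smaller one is at most their average
    with weights [f] and [1 - f]; sum and take [l = S / 2]. *)
Lemma affinity_le_risk (R : realFieldType) (W : finType) (a b f : W -> R) :
  (forall w, 0 <= a w) -> (forall w, 0 <= b w) ->
  \sum_w a w ^+ 2 = 1 -> \sum_w b w ^+ 2 = 1 ->
  (forall w, 0 <= f w <= 1) ->
  (\sum_w a w * b w) ^+ 2 / 2 <=
    \sum_w a w ^+ 2 * f w + \sum_w b w ^+ 2 * (1 - f w).
Proof.
move=> a0 b0 a1 b1 f01; set S := \sum_w a w * b w; pose l := S / 2.
suff : \sum_w 2 * l * (a w * b w) <=
    \sum_w (a w ^+ 2 * f w + b w ^+ 2 * (1 - f w) + l ^+ 2 * (a w ^+ 2 + b w ^+ 2)).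
  by rewrite -mulr_sumr -/S !big_split/= -mulr_sumr big_split/= a1 b1 /l; lra.
apply: ler_sum => w _.
have /andP[f0 f1] := f01 w; have := a0 w; have := b0 w.
move: (a w) (b w) (f w) f0 f1 => x y z z0 z1 y0 x0.
have [xy|/ltW yx] := leP x y.
  have : 0 <= (x - l * y) ^+ 2 by exact: sqr_ge0.
  have : 0 <= (y - x) * (y + x) * (1 - z) by rewrite !mulr_ge0//; lra.
  have : 0 <= (l * x) ^+ 2 by exact: sqr_ge0.
  nra.
have : 0 <= (y - l * x) ^+ 2 by exact: sqr_ge0.
have : 0 <= (x - y) * (y + x) * z by rewrite !mulr_ge0//; lra.
have : 0 <= (l * y) ^+ 2 by exact: sqr_ge0.
nra.
Qed.

(** Replacing the entries of [x] by those of [y] one at a time turns a bound for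
    neighbours into a Lipschitz bound for the Hamming distance. *)
Lemma hamming_lipschitz (R : realFieldType) (I : finType) (T : eqType)
    (f : (I -> T) -> R) (D : R) :
  (forall x y : I -> T,
    (forall i j, x i <> y i -> x j <> y j -> i = j) -> f y - f x <= D) ->
  forall x y, f y - f x <= D * \sum_i (x i != y i)%:R.
Proof.
move=> fD x y; pose z (s : seq I) i := if i \in s then y i else x i.
suff H (s : seq I) : f (z s) - f x <= D * \sum_(i <- s) (x i != y i)%:R.
  have := H (enum I); rewrite big_enum/= (_ : z _ = y)//.
  by apply/funext => i; rewrite /z mem_enum.
elim: s => [|i s IH].
  by rewrite big_nil mulr0 (_ : z [::] = x) ?subrr//; apply/funext.
rewrite big_cons mulrDr; have [xyi|xyi] := eqVneq (x i) (y i).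
  rewrite mulr0 add0r (_ : z (i :: s) = z s)//; apply/funext => j.
  by rewrite /z in_cons; case: eqVneq => //= ->; rewrite xyi; case: ifP.
rewrite mulr1 -(subrKA (f (z s))) lerD//; apply: fD => j k.
rewrite /z !in_cons; case: eqVneq => [->|_ /=]; last by [].
by move=> _; case: eqVneq => [->|_ /=].
Qed.

(** * Rejection probability of a randomized test *)

Section tests.
Context (R : realType) d (X : measurableType d) (n : nat).
Implicit Type phi : test R X n.
Local Open Scope ereal_scope.

Definition rejection phi (x : dataset X n) : \bar R :=
  \int[aux_law phi]_u output phi (x, u) [set true].

Lemma integral_aux_cst phi (r : R) : \int[aux_law phi]_u r%:E = r%:E.
Proof.
rewrite integral_cst// -[RHS]mule1; congr (_ * _).
exact: (probability_setT (aux_law phi)).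
Qed.

Lemma output_set_le1 phi z (S : set bool) : 0 <= output phi z S <= 1.
Proof.
rewrite measure_ge0/= -(prob_kernel (s := output phi) z).
by rewrite le_measure ?inE.
Qed.

Lemma output_false phi z :
  output phi z [set false] = 1 - output phi z [set true].
Proof.
have UT : [set true] `|` [set false] = [set: bool].
  by apply/seteqP; split => // -[] _; [left|right].
rewrite -(prob_kernel (s := output phi) z) -UT.
rewrite measureU//=; last by apply/seteqP; split => // -[] [].
have /andP[h0 h1] := output_set_le1 z [set true].
by rewrite [X in _ = X - _]addeC addeK// ge0_fin_numE// (le_lt_trans h1)// ltry.
Qed.

Lemma measurable_output phi (x : dataset X n) (S : set bool) :
  measurable_fun [set: aux phi] (fun u => output phi (x, u) S).
Proof.
have -> : (fun u => output phi (x, u) S) = (fun z => output phi z S) \o pair x by [].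
apply: measurableT_comp; last exact: measurable_pair1.
exact: measurable_kernel.
Qed.

Lemma rejection_fin phi x : 0 <= rejection phi x <= 1.
Proof.
rewrite integral_ge0/= => [|u _]; last exact: measure_ge0.
apply: (@le_trans _ _ (\int[aux_law phi]_u 1)); last first.
  by rewrite integral_aux_cst.
apply: ge0_le_integral => //; first exact: measurable_output.
by move=> u _; case/andP: (output_set_le1 (x, u) [set true]).
Qed.

(** Accepting and rejecting exhaust the outputs, so only [rejection] is needed
    to describe both error types. *)
Lemma acceptance phi x :
  \int[aux_law phi]_u output phi (x, u) [set false] = 1 - rejection phi x.
Proof.
have h : \int[aux_law phi]_u output phi (x, u) [set false] + rejection phi x = 1.
  rewrite -ge0_integralD//; [|exact: measurable_output|exact: measurable_output].
  under eq_integral => u _.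
    rewrite output_false subeK; last first.
      have /andP[h0 h1] := output_set_le1 (x, u) [set true].
      by rewrite ge0_fin_numE// (le_lt_trans h1)// ltry.
    over.
  by rewrite integral_aux_cst.
have /andP[h0 h1] := rejection_fin phi x.
by rewrite -h addeK// ge0_fin_numE// (le_lt_trans h1)// ltry.
Qed.

Definition power phi x : R := fine (rejection phi x).

Lemma powerE phi x : rejection phi x = (power phi x)%:E.
Proof.
have /andP[h0 h1] := rejection_fin phi x.
by rewrite /power fineK// ge0_fin_numE// (le_lt_trans h1)// ltry.
Qed.

Lemma power_itv phi x : (0 <= power phi x <= 1)%R.
Proof. by have := rejection_fin phi x; rewrite powerE !lee_fin. Qed.

Lemma measurable_power phi : measurable_fun [set: dataset X n] (power phi).
Proof.
apply/measurable_EFinP.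
have -> : EFin \o power phi =
  fubini_F (aux_law phi) (fun z => output phi z [set true]).
  by apply/funext => x /=; rewrite -powerE.
apply: measurable_fun_fubini_tonelli_F => //.
exact: measurable_kernel.
Qed.

Lemma test_expectation_reject (P : probability X R) phi :
  test_expectation P phi (fun b => b%:R)%R = \int[iid_law n P]_x (power phi x)%:E.
Proof.
apply: eq_integral => x _; rewrite -powerE; apply: eq_integral => u _.
rewrite -[[set true]]setIT -integral_indic//.
apply: eq_integral => b _; congr EFin; rewrite indicE.
by case: b; [rewrite mem_set|rewrite memNset].
Qed.

Lemma test_expectation_accept (P : probability X R) phi :
  test_expectation P phi (fun b => 1 - b%:R)%R =
  \int[iid_law n P]_x (1 - power phi x)%R%:E.
Proof.
apply: eq_integral => x _; rewrite EFinB -powerE -acceptance.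
apply: eq_integral => u _; rewrite -[[set false]]setIT -integral_indic//.
apply: eq_integral => b _; congr EFin; rewrite indicE.
by case: b; [rewrite memNset// subrr|rewrite mem_set// subr0].
Qed.

(** Privacy holds for each value of the auxiliary variable; integrating over it
    gives privacy of the overall rejection probability, for both output values. *)
Lemma dp_power eps delta phi x y : (0 <= delta)%R -> dp eps delta phi ->
  neighbours x y ->
  (power phi x <= expR eps * power phi y + delta)%R /\
  (1 - power phi x <= expR eps * (1 - power phi y) + delta)%R.
Proof.
move=> d0 pdp xy.
have H S : \int[aux_law phi]_u output phi (x, u) S <=
  (expR eps)%:E * \int[aux_law phi]_u output phi (y, u) S + delta%:E.
  have -> : delta%:E = \int[aux_law phi]_u delta%:E.
    by rewrite integral_aux_cst.
  rewrite -ge0_integralZl_EFin ?expR_ge0//; last exact: measurable_output.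
  rewrite -ge0_integralD//; last first.
    by apply: measurable_funeM; exact: measurable_output.
  apply: ge0_le_integral => //; first exact: measurable_output.
    apply: emeasurable_funD => //.
    by apply: measurable_funeM; exact: measurable_output.
  by move=> u _; exact: pdp.
split.
  by have := H [set true]; rewrite -!/(rejection _ _) !powerE -EFinM -EFinD lee_fin.
have := H [set false].
by rewrite !acceptance !powerE -!EFinB -EFinM -EFinD lee_fin.
Qed.

End tests.

(** Adding the two privacy inequalities gives
    [(1 + e^eps) (b - a) <= e^eps - 1 + 2 delta]. Hence
    [b - a <= 1 - 2 (1 - delta) / (1 + e^eps) <= 1 - e^(- eps) (1 - delta)], and
    the last expression is [1 - e^(- xi) <= xi]. *)
Lemma ler_sub_dp (R : realType) (eps delta a b : R) :
  0 <= eps -> 0 <= delta < 1 ->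
  b <= expR eps * a + delta -> 1 - a <= expR eps * (1 - b) + delta ->
  b - a <= xi eps delta.
Proof.
move=> e0 /andP[d0 d1] h1 h2.
have E1 : 1 + eps <= expR eps by exact: expR_ge1Dx.
have d1' : 0 < 1 - delta by lra.
have xiE : expR (- xi eps delta) = expR (- eps) * (1 - delta).
  rewrite /xi opprD expRD; congr (_ * _).
  by rewrite div1r lnV ?posrE// opprK lnK ?posrE.
have := expR_ge1Dx (- xi eps delta); rewrite xiE expRN.
suff : b - a <= 1 - (expR eps)^-1 * (1 - delta) by lra.
set E := expR eps in E1 h1 h2 *.
have E0 : 0 < E by lra.
have : E * E^-1 = 1 by rewrite divff// gt_eqF.
have : 0 < E^-1 by rewrite invr_gt0.
move: (E^-1) => V V0 EV.
suff : (1 + E) * (b - a) <= (1 + E) * (1 - V * (1 - delta)).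
  by rewrite ler_pM2l//; lra.
have V1 : V <= 1 by nra.
have : 0 <= (1 - delta) * (1 - V) by rewrite mulr_ge0//; lra.
have -> : (1 + E) * (1 - V * (1 - delta)) =
  1 + E - V * (1 - delta) - E * V * (1 - delta) by ring.
rewrite EV; lra.
Qed.

(** * Total error of a test on two finitely supported laws *)

Section two_points.
Context (R : realType) d (X : measurableType d) (n : nat) (V : finType).
Implicit Types (P : probability X R) (q : V -> R) (e : V -> X).
Implicit Type phi : test R X n.

Let sample e (w : {ffun 'I_n -> V}) : dataset X n := fun i => e (w i).

Lemma reject_atoms P q e phi : (forall v, 0 <= q v) -> \sum_v q v = 1 ->
  has_atoms P q e ->
  test_expectation P phi (fun b => b%:R) =
  (\sum_(w : {ffun 'I_n -> V}) (\prod_i q (w i)) * power phi (sample e w))%:E.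
Proof.
move=> q0 q1 Pqe; rewrite test_expectation_reject.
rewrite (@ge0_integral_atoms _ _ _ _ _
  (fun w : {ffun 'I_n -> V} => \prod_i q (w i)) (sample e)).
- by rewrite -sumEFin; apply: eq_bigr => w _; rewrite EFinM.
- by move=> w; exact: prodr_ge0.
- exact: (@product_atoms _ _ _ _ _ _ (fun=> q) (fun=> e)).
- by apply/measurable_EFinP; exact: measurable_power.
- by move=> x; rewrite lee_fin; case/andP: (power_itv phi x).
Qed.

Lemma accept_atoms P q e phi : (forall v, 0 <= q v) -> \sum_v q v = 1 ->
  has_atoms P q e ->
  test_expectation P phi (fun b => 1 - b%:R) =
  (\sum_(w : {ffun 'I_n -> V}) (\prod_i q (w i)) * (1 - power phi (sample e w)))%:E.
Proof.
move=> q0 q1 Pqe; rewrite test_expectation_accept.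
rewrite (@ge0_integral_atoms _ _ _ _ _
  (fun w : {ffun 'I_n -> V} => \prod_i q (w i)) (sample e)).
- by rewrite -sumEFin; apply: eq_bigr => w _; rewrite EFinM.
- by move=> w; exact: prodr_ge0.
- exact: (@product_atoms _ _ _ _ _ _ (fun=> q) (fun=> e)).
- apply/measurable_EFinP; apply: measurable_funB => //; exact: measurable_power.
- by move=> x; rewrite lee_fin; have := power_itv phi x; lra.
Qed.

(** The affinity of two product laws is the [n]-th power of the affinity of the
    factors, by distributing the product over the sum. *)
Lemma risk_affinity P0 P1 q0 q1 e phi :
  (forall v, 0 <= q0 v) -> (forall v, 0 <= q1 v) ->
  \sum_v q0 v = 1 -> \sum_v q1 v = 1 ->
  has_atoms P0 q0 e -> has_atoms P1 q1 e ->
  ((((\sum_v Num.sqrt (q0 v) * Num.sqrt (q1 v)) ^+ n) ^+ 2 / 2)%R%:E <=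
  test_expectation P0 phi (fun b => b%:R)%R +
  test_expectation P1 phi (fun b => 1 - b%:R)%R)%E.
Proof.
move=> q00 q10 q01 q11 P0q P1q.
rewrite (reject_atoms _ q00 q01 P0q) (accept_atoms _ q10 q11 P1q) -EFinD lee_fin.
have sqrt_prod q (w : {ffun 'I_n -> V}) : (forall v, 0 <= q v) ->
    \prod_i q (w i) = (\prod_i Num.sqrt (q (w i))) ^+ 2.
  by move=> q_ge0; rewrite -prodrXl; apply: eq_bigr => i _; rewrite sqr_sqrtr.
have prod1 q : \sum_v q v = 1 -> \sum_(w : {ffun 'I_n -> V}) \prod_i q (w i) = 1.
  by move=> q1_; rewrite -(bigA_distr_bigA (fun _ v => q v))/= big1.
have -> : (\sum_v Num.sqrt (q0 v) * Num.sqrt (q1 v)) ^+ n =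
    \sum_(w : {ffun 'I_n -> V})
      (\prod_i Num.sqrt (q0 (w i))) * (\prod_i Num.sqrt (q1 (w i))).
  rewrite -[in LHS](card_ord n) -prodr_const bigA_distr_bigA/=.
  by apply: eq_bigr => w _; rewrite big_split.
under [X in _ <= X + _]eq_bigr do rewrite sqrt_prod//.
under [X in _ <= _ + X]eq_bigr do rewrite sqrt_prod//.
apply: affinity_le_risk => [w|w| | |w].
- by apply: prodr_ge0 => i _; exact: sqrtr_ge0.
- by apply: prodr_ge0 => i _; exact: sqrtr_ge0.
- by under eq_bigr do rewrite -sqrt_prod//; exact: prod1.
- by under eq_bigr do rewrite -sqrt_prod//; exact: prod1.
- exact: power_itv.
Qed.

(** Having the same weights [q] with two supports [e0], [e1] is a coupling of
    [P0] and [P1]. The coupled samples differ at [n * q(e0 <> e1)] places on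
    average, and each place moves the rejection probability by at most
    [xi eps delta]. *)
Lemma risk_coupling P0 P1 q e0 e1 phi eps delta :
  (forall v, 0 <= q v) -> \sum_v q v = 1 ->
  has_atoms P0 q e0 -> has_atoms P1 q e1 ->
  0 <= eps -> 0 <= delta < 1 -> dp eps delta phi ->
  ((1 - xi eps delta * (n%:R * \sum_v q v * (e0 v != e1 v)%:R))%R%:E <=
  test_expectation P0 phi (fun b => b%:R)%R +
  test_expectation P1 phi (fun b => 1 - b%:R)%R)%E.
Proof.
move=> q0 q1 P0q P1q eps0 delta01 pdp.
rewrite (reject_atoms _ q0 q1 P0q) (accept_atoms _ q0 q1 P1q) -EFinD lee_fin.
have -> : n%:R * \sum_v q v * (e0 v != e1 v)%:R =
    \sum_(w : {ffun 'I_n -> V}) (\prod_i q (w i)) *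
      \sum_i (e0 (w i) != e1 (w i))%:R.
  under [RHS]eq_bigr do rewrite mulr_sumr.
  rewrite exchange_big/= -[X in X%:R](card_ord n) -sumr_const mulr_suml.
  apply: eq_bigr => i _; rewrite mul1r.
  (* The weights of the places other than [i] sum to one. *)
  pose F (j : 'I_n) v := q v * (if j == i then (e0 v != e1 v)%:R else 1).
  transitivity (\prod_j \sum_v F j v).
    rewrite (bigD1 i)//= [X in _ * X]big1 ?mulr1 => [|j /negbTE ji].
      by apply: eq_bigr => v _; rewrite /F eqxx.
    by under eq_bigr do rewrite /F ji mulr1.
  rewrite bigA_distr_bigA; apply: eq_bigr => w _.
  rewrite big_split/=; congr (_ * _).
  by rewrite (bigD1 i)//= eqxx big1 ?mulr1// => j /negbTE ->.
have {1}<- : \sum_(w : {ffun 'I_n -> V}) \prod_i q (w i) = 1.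
  by rewrite -(bigA_distr_bigA (fun _ v => q v))/= big1.
rewrite mulr_sumr -sumrB -big_split/=; apply: ler_sum => w _.
set W := \prod_i _; have W0 : 0 <= W by exact: prodr_ge0.
have : power phi (sample e1 w) - power phi (sample e0 w) <=
    xi eps delta * \sum_i (e0 (w i) != e1 (w i))%:R.
  apply: (@hamming_lipschitz R 'I_n X (power phi)) => x y xy.
  have [_ h] := dp_power (proj1 (andP delta01)) pdp xy.
  have yx : neighbours y x by move=> i j /nesym xi /nesym xj; exact: xy.
  have [h' _] := dp_power (proj1 (andP delta01)) pdp yx.
  exact: ler_sub_dp h' h.
by move=> /(ler_wpM2l W0); lra.
Qed.

(** The level constraint bounds the error under [P0] by [alpha], so what remains
    of the total error [s] has to be incurred under [P1]. *)
Lemma le_cam_minimax (H0 H1 : set (probability X R)) P0 P1 alpha eps delta s :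
  H0 P0 -> H1 P1 ->
  (forall phi, dp eps delta phi -> s%:E <=
    test_expectation P0 phi (fun b => b%:R)%R +
    test_expectation P1 phi (fun b => 1 - b%:R)%R)%E ->
  ((s - alpha)%:E <= minimax_type2 n H0 H1 alpha eps delta)%E.
Proof.
move=> HP0 HP1 le_risk; apply/ereal_infP => _ [phi [level pdp] ->].
have le_sup (H : set (probability X R)) P g : H P -> (test_expectation P phi g <=
    sup_or_0 [set test_expectation P phi g | P in H])%E.
  move=> HP; rewrite /sup_or_0 ifF; first by apply: ereal_sup_ubound; exists P.
  by apply/negP => /eqP/seteqP[+ _] => /(_ (test_expectation P phi g)); apply; exists P.
apply: le_trans (le_sup _ _ _ HP1).
have := le_trans (le_sup _ _ (fun b => b%:R) HP0) level.
have := le_risk phi pdp.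
move: (test_expectation P0 phi _) (test_expectation P1 phi _) => a b.
rewrite EFinB leeBlDr// => h1 h2; apply: le_trans h1 _.
by rewrite addeC leeD2l.
Qed.

End two_points.

(** * dHSIC of finitely supported laws *)

Lemma measurable_continuous_mx (R : realType) m n (f : 'M[R]_(m, n) -> R) :
  continuous f -> measurable_fun [set: 'M[R]_(m, n)] f.
Proof.
move=> /continuousP cf; apply: (measurability _ (RGenOpens.measurableE R)).
move=> _ [_ [x [y ->]] <-]; rewrite setTI; apply: sub_sigma_algebra.
by apply: cf; exact: interval_open.
Qed.

Section rkhs_combinations.
Context (R : realType) (T : Type) (k : T -> T -> R) (H : function_hilbert R T).
Context (rkhsH : is_rkhs k H).

(** By linearity and the reproducing property: such an [f] represents the linear
    form [h |-> \sum_v c v * h (e v)], that is, integration against a finite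
    signed measure. *)
Lemma rkhs_combination (V : finType) (c : V -> R) (e : V -> T) :
  let f := \sum_v c v *: k^~ (e v) in
  fh_mem H f /\ forall h, fh_mem H h -> fh_ip H f h = \sum_v c v * h (e v).
Proof.
case: rkhsH => mk rep; suff on_seq s : let f := \sum_(v <- s) c v *: k^~ (e v) in
    fh_mem H f /\ forall h, fh_mem H h -> fh_ip H f h = \sum_(v <- s) c v * h (e v).
  have [] := on_seq (enum V); rewrite big_enum/= => mf ipf.
  by split=> // h mh; rewrite ipf// big_enum.
elim: s => [|v s [mf ipf]] f; rewrite {}/f.
  rewrite big_nil; split=> [|h mh]; first exact: fh_mem0.
  rewrite big_nil; have := fh_ip_linear 1 (fh_mem0 H) (fh_mem0 H) mh.
  by rewrite scale1r addr0 mul1r -[LHS]addr0 => /addrI/esym.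
rewrite big_cons; split=> [|h mh]; first exact: fh_memD.
by rewrite fh_ip_linear// big_cons ipf// fh_ipC// rep.
Qed.

End rkhs_combinations.

Section finitely_supported_dHSIC.
Context (R : realType) d (p : 'I_d -> nat).

(** The witness is the embedding of the signed measure [P - \prod_j P_j] divided
    by its norm; its integral against that measure is again the norm. *)
Lemma dHSIC_atoms (k : joint R p -> joint R p -> R)
    (H : function_hilbert R (joint R p)) (P : probability (joint R p) R)
    (V : finType) (q q' : V -> R) (e : V -> joint R p) :
  is_rkhs k H -> (forall y, measurable_fun setT (k^~ y)) ->
  (forall v, 0 <= q v) -> (forall v, 0 <= q' v) ->
  has_atoms P q e -> has_atoms (product_of_marginals P) q' e ->
  ((Num.sqrt (\sum_v (q v - q' v) * \sum_w (q w - q' w) * k (e v) (e w)))%:E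
    <= dHSIC H P)%E.
Proof.
move=> rH mk q0 q'0 Pq Pq'; set Q := \sum_v _; set N := Num.sqrt Q.
(* If [N = 0] then [c = 0], and the witness is the zero function. *)
pose c v := (q v - q' v) / N; pose f := \sum_v c v *: k^~ (e v).
have [mf ipf] := rkhs_combination rH c e.
have fE x : f x = \sum_w c w * k x (e w).
  by rewrite /f fct_sumE.
have fQ : \sum_v (q v - q' v) * f (e v) = Q / N.
  rewrite /Q mulr_suml; apply: eq_bigr => v _.
  rewrite fE -mulrA; congr (_ * _); rewrite mulr_suml.
  by apply: eq_bigr => w _; rewrite /c; ring.
have QN : Q / N = N.
  have [N0|N0] := eqVneq N 0; first by rewrite N0 invr0 mulr0.
  have Q0 : 0 <= Q by rewrite leNgt; apply/negP => /ltW/ler0_sqrtr/eqP; apply/negP.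
  by rewrite -{1}(sqr_sqrtr Q0) -/N expr2 mulfK.
have ipff : fh_ip H f f <= 1.
  rewrite ipf// /c; under eq_bigr do rewrite mulrAC.
  rewrite -mulr_suml fQ QN; have [->|N0] := eqVneq N 0; first by rewrite mul0r.
  by rewrite divff.
have mfT : measurable_fun [set: joint R p] f.
  rewrite (_ : f = fun x => \sum_w c w * k x (e w)); last exact/funext.
  by apply: measurable_sum => w; apply: measurable_funM.
apply: ereal_sup_ubound; exists f.
  split=> //; rewrite /fh_norm -[leRHS](@sqrtr1 R); exact: ler_wsqrtr.
rewrite (expectation_atoms q0 Pq mfT) (expectation_atoms q'0 Pq' mfT).
rewrite -EFinB -sumrB; congr EFin; rewrite -QN -fQ.
by apply: eq_bigr => v _; rewrite mulrBl.
Qed.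

Lemma measurable_tensor_kernel (k : forall j : 'I_d, 'rV[R]_(p j) -> 'rV[R]_(p j) -> R)
    (y : joint R p) :
  (forall j, continuous (fun z : 'rV[R]_(p j) * 'rV[R]_(p j) => k j z.1 z.2)) ->
  measurable_fun [set: joint R p] ((tensor_kernel k)^~ y).
Proof.
move=> kc.
apply: (measurable_prod (h := fun j (x : joint R p) => k j (x j) (y j))) => j _.
apply: (measurableT_comp (f := fun x => k j x (y j)) (g := @dproj 'I_d _ _ j)).
  apply: measurable_continuous_mx => x.
  apply: (@continuous_comp _ _ _ (fun x => (x, y j)) (fun z => k j z.1 z.2)).
    move=> U [[A B] /= [nA nB] AB]; apply: filterS nA => z Az.
    by apply: AB; split => //=; exact: nbhs_singleton.
  exact: kc.
exact: measurable_dproj.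
Qed.

End finitely_supported_dHSIC.

(** * The four-point laws *)

Section four_point_law.
Context (R : realType) d (p : 'I_d -> nat).
Context (j0 j1 : 'I_d) (x0 : forall j, 'rV[R]_(p j)) (j01 : j1 != j0).

(** Two bits choose the corner; every coordinate other than [j0] and [j1] keeps
    the bit [false]. *)
Definition bit (v : bool * bool) (j : 'I_d) : bool :=
  if j == j0 then v.1 else (j == j1) && v.2.

Definition corner (v : bool * bool) : joint R p :=
  fun j => if bit v j then x0 j else 0.

Definition sgn (v : bool * bool) : R := if v.1 == v.2 then 1 else -1.

Definition corr_weight (t : R) v : R := 1 / 4 + t * sgn v.

Lemma sum_bool2 (F : bool * bool -> R) : \sum_v F v =
  F (true, true) + F (true, false) + (F (false, true) + F (false, false)).
Proof.
transitivity (\sum_v F (v.1, v.2)); first by apply: eq_bigr => -[].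
by rewrite -(pair_bigA _ (fun a b => F (a, b)))/= !big_bool.
Qed.

Lemma corr_weight_ge0 t v : 0 <= t <= 1 / 4 -> 0 <= corr_weight t v.
Proof. by move=> t01; rewrite /corr_weight /sgn; case: ifP => _; lra. Qed.

Lemma sum_corr_weight t : \sum_v corr_weight t v = 1.
Proof. by rewrite sum_bool2 /corr_weight /sgn/=; lra. Qed.

(** A product over the coordinates of terms depending only on the bits of two
    corners separates into the factors at [j0] and [j1] and a constant. This one
    identity serves indicators of rectangles and product kernels alike. *)
Lemma prod_bit (G : 'I_d -> bool -> bool -> R) v w :
  \prod_j G j (bit v j) (bit w j) = G j0 v.1 w.1 * (G j1 v.2 w.2 *
    \prod_(j | (j != j0) && (j != j1)) G j false false).
Proof.
rewrite (bigD1 j0)//= (bigD1 j1)//= /bit !eqxx (negbTE j01)/=.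
congr (_ * (_ * _)); apply: eq_bigr => j /andP[/negbTE j_j0 /negbTE j_j1].
by rewrite j_j0 j_j1.
Qed.

(** Each of the bits is uniform whatever [t] is, so the product of the marginals
    is the law in which the bits are independent. *)
Lemma product_of_marginals_corr (P Q : probability (joint R p) R) t :
  has_atoms P (corr_weight t) corner -> has_atoms Q (corr_weight 0) corner ->
  forall A, measurable A -> Q A = product_of_marginals P A.
Proof.
move=> Pt Q0; apply: product_probability_unique => A mA.
apply: etrans (Q0 _ (measurable_rect mA)) _.
have mE j : marginal P j (A j) = (\sum_v corr_weight t v * \1_(A j) (corner v j))%:E.
  apply: etrans (Pt (dproj j @^-1` A j) _) _.
    rewrite -[X in measurable X]setTI.
    exact: (@measurable_dproj _ _ _ j measurableT _ (mA j)).
  by congr EFin; apply: eq_bigr => v _; congr (_ * _); rewrite !indicE.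
under [RHS]eq_bigr do rewrite mE.
rewrite prodEFin; congr EFin.
have rectE v : \1_(rect A) (corner v) = \prod_j \1_(A j) (corner v j) :> R.
  rewrite indicE; have [|] := boolP (corner v \in rect A).
    by rewrite inE => h; rewrite big1// => j _; rewrite indicE mem_set//; exact: h.
  rewrite notin_setE => /existsNP[j Hj].
  by rewrite (bigD1 j)//= indicE memNset// mul0r.
under [LHS]eq_bigr do
  rewrite rectE
    (prod_bit (fun j b _ => \1_(A j) (if b then x0 j else 0)) _ (false, false)).
rewrite [RHS](bigD1 j0)//= [X in _ = _ * X](bigD1 j1)//=.
under [X in _ = _ * (_ * X)]eq_bigr => j /andP[/negbTE j_j0 /negbTE j_j1].
  rewrite (_ : \sum_v _ = \1_(A j) 0); last first.
    by rewrite sum_bool2 /corner /bit j_j0 j_j1 /corr_weight /sgn/=; lra.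
  over.
rewrite !sum_bool2 /corner /bit /corr_weight /sgn/= !eqxx (negbTE j01)/=.
by field.
Qed.

End four_point_law.

(** * dHSIC of the four-point laws *)

Lemma psd_kernel_pair (R : realType) (T : Type) (k : T -> T -> R) x y :
  psd_kernel k -> 0 <= k x x + 2 * k x y + k y y.
Proof.
move=> [sym psd].
have := psd 2%N (fun i => if i == ord0 then x else y) (fun=> 1).
rewrite !big_ord_recl !big_ord0/= (sym y x); lra.
Qed.

Section corr_dHSIC.
Context (R : realType) d (p : 'I_d -> nat).
Context (k : forall j : 'I_d, 'rV[R]_(p j) -> 'rV[R]_(p j) -> R).
Context (kappa : forall j : 'I_d, 'rV[R]_(p j) -> R) (eta : 'I_d -> R).
Context (x0 : forall j, 'rV[R]_(p j)) (j0 j1 : 'I_d).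
Arguments k : clear implicits.
Arguments kappa : clear implicits.
Context (j01 : j1 != j0).
Context (eta0 : forall j, 0 < eta j).
Context (psd_k : forall j, psd_kernel (k j)).
Context (kE : forall j x x', k j x x' = kappa j (x - x')).
Context (kappa_gap : forall j, eta j <= kappa j 0 - kappa j (x0 j)).

Lemma kappaN j x : kappa j (- x) = kappa j x.
Proof. by rewrite -[x in RHS]subr0 -kE (psd_k j).1 kE sub0r. Qed.

(** Testing positive semi-definiteness on the points [x0 j] and [0] with equal
    coefficients gives [kappa j (x0 j) >= - kappa j 0]; combine this with
    [kappa_gap]. *)
Lemma kappa0_ge j : eta j / 2 <= kappa j 0.
Proof.
have := psd_kernel_pair (x0 j) 0 (psd_k j); have := kappa_gap j.
by rewrite !kE !subrr subr0; lra.
Qed.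

(** The part of the squared norm in [corr_gram] that remains after each kernel
    value has been bounded in terms of [eta]. *)
Definition gap_product : R :=
  4 * (eta j0 * (eta j1 * \prod_(j | (j != j0) && (j != j1)) (eta j / 2))).

Lemma gap_product_gt0 : 0 < gap_product.
Proof.
rewrite /gap_product !mulr_gt0//.
by apply: prodr_gt0 => j _; rewrite divr_gt0.
Qed.

Local Notation K := (tensor_kernel k).
Local Notation corner := (corner j0 j1 x0).

(** The signed weights [t * sgn v] factor over the two bits, and so does the
    kernel. Each selected coordinate contributes
    [2 * (kappa j 0 - kappa j (x0 j))], the squared norm of a difference of two
    features; each other coordinate contributes [kappa j 0]. *)
Lemma corr_gram t :
  \sum_v (corr_weight t v - corr_weight 0 v) *
    \sum_w (corr_weight t w - corr_weight 0 w) * K (corner v) (corner w) =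
  t ^+ 2 * (4 * ((kappa j0 0 - kappa j0 (x0 j0)) *
    ((kappa j1 0 - kappa j1 (x0 j1)) *
     \prod_(j | (j != j0) && (j != j1)) kappa j 0))).
Proof.
pose G j (a b : bool) := k j (if a then x0 j else 0) (if b then x0 j else 0).
have KE v w : K (corner v) (corner w) = G j0 v.1 w.1 * (G j1 v.2 w.2 *
    \prod_(j | (j != j0) && (j != j1)) G j false false).
  exact: (prod_bit j01 G).
rewrite sum_bool2 !(sum_bool2 (fun w => _ * _)) !KE /G !kE/=.
under eq_bigr do rewrite kE subr0.
rewrite !subrr !subr0 !sub0r !kappaN /corr_weight /sgn/=.
ring.
Qed.

Lemma corr_dHSIC (H : function_hilbert R (joint R p)) (P Q : probability (joint R p) R)
    (t : R) :
  (forall j, continuous (fun z : 'rV[R]_(p j) * 'rV[R]_(p j) => k j z.1 z.2)) ->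
  is_rkhs K H -> 0 <= t <= 1 / 4 ->
  has_atoms P (corr_weight t) corner -> has_atoms Q (corr_weight 0) corner ->
  ((t * Num.sqrt gap_product)%:E <= dHSIC H P)%E.
Proof.
move=> kc rH t01 Pt Q0.
have M0 : has_atoms (product_of_marginals P) (corr_weight 0) corner.
  move=> A mA; rewrite -Q0//; symmetry.
  exact: (product_of_marginals_corr j01 Pt Q0).
have t0 : 0 <= (0 : R) <= 1 / 4 by lra.
apply: le_trans (dHSIC_atoms rH _ _ _ Pt M0); last first.
- by move=> v; exact: corr_weight_ge0.
- by move=> v; exact: corr_weight_ge0.
- by move=> y; exact: measurable_tensor_kernel.
rewrite lee_fin corr_gram [leRHS]sqrtrM ?sqr_ge0// sqrtr_sqr ger0_norm; last lra.
apply: ler_wpM2l; first lra.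
apply: ler_wsqrtr; rewrite /gap_product ler_pM2l//.
have prod_le : \prod_(j | (j != j0) && (j != j1)) (eta j / 2) <=
    \prod_(j | (j != j0) && (j != j1)) kappa j 0.
  by apply: ler_prod => j _; rewrite kappa0_ge divr_ge0// ltW.
have prod_ge : 0 <= \prod_(j | (j != j0) && (j != j1)) (eta j / 2).
  by apply: prodr_ge0 => j _; rewrite divr_ge0// ltW.
have eta_ge0 j : 0 <= eta j by exact: ltW.
apply: ler_pM => //; first by rewrite mulr_ge0.
by apply: ler_pM.
Qed.

End corr_dHSIC.

(** * Affinity and coupling of the four-point laws *)

(** Equivalently [1 <= (1 - x) e^(2 x)], which follows from [1 + x <= e^x]
    because [(1 - x) (1 + x)^2 = 1 + x (1 - x - x^2)]. *)
Lemma expR_le_onem (R : realType) (x : R) : 0 <= x <= 1 / 2 ->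
  expR (- (2 * x)) <= 1 - x.
Proof.
move=> x01; rewrite expRN -div1r ler_pdivrMr ?expR_gt0//.
have -> : 2 * x = x + x by lra.
rewrite expRD; have := expR_ge1Dx x; set E := expR x => h.
have : (1 + x) * (1 + x) <= E * E by rewrite ler_pM//; lra.
have : 0 <= x * (1 - x - x * x) by rewrite mulr_ge0//; nra.
nra.
Qed.

(** The polynomial [1 + y / 2 - y^2 / 2 = (1 + y) (1 - y / 2)] lies below
    [sqrt (1 + y)] on the interval from [-1] to [1]. In the average over
    [y = 4 t] and [y = - 4 t] its linear term cancels. *)
Lemma corr_affinity (R : realType) (t : R) : 0 <= t <= 1 / 4 ->
  1 - 8 * t ^+ 2 <=
  \sum_v Num.sqrt (corr_weight 0 v) * Num.sqrt (corr_weight t v).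
Proof.
move=> t01.
have sqrt_ge (a u : R) : a ^+ 2 <= u -> a <= Num.sqrt u.
  by move=> au; rewrite (le_trans (ler_norm a))// -sqrtr_sqr ler_wsqrtr.
have half : 1 / 2 <= Num.sqrt (1 / 4) :> R by apply: sqrt_ge; lra.
have bound (y : R) : -1 <= y <= 1 -> 1 / 2 * (1 / 2 * (1 + y / 2 - y ^+ 2 / 2)) <=
    Num.sqrt (1 / 4) * Num.sqrt (1 / 4 + y / 4).
  move=> y11; have y0 : 0 <= 1 + y / 2 - y ^+ 2 / 2.
    have : 0 <= (1 + y) * (1 - y / 2) by rewrite mulr_ge0//; lra.
    nra.
  apply: ler_pM; [lra|lra|exact: half|apply: sqrt_ge].
  have h : 0 <= y ^+ 2 * (3 - y) by rewrite mulr_ge0 ?sqr_ge0//; lra.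
  have : 0 <= (1 + y) * (y ^+ 2 * (3 - y)) by rewrite mulr_ge0//; lra.
  nra.
have b1 := bound (4 * t) ltac:(lra); have b2 := bound (- (4 * t)) ltac:(lra).
rewrite sum_bool2 /corr_weight /sgn/= !mul0r !addr0 mulr1 mulrN1.
have -> : 1 / 4 + t = 1 / 4 + 4 * t / 4 by lra.
have -> : 1 / 4 - t = 1 / 4 + - (4 * t) / 4 by lra.
nra.
Qed.

Section corr_coupling.
Context (R : realType) d (p : 'I_d -> nat) (j0 j1 : 'I_d).
Context (x0 : forall j, 'rV[R]_(p j)).
Local Notation corner := (corner j0 j1 x0).

(** Two independent uniform bits, together with an independent coin that shows
    [true] with probability [4 * t]. *)
Definition coupling_weight (t : R) (v : bool * bool * bool) : R :=
  1 / 4 * (if v.2 then 4 * t else 1 - 4 * t).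

(** When the coin shows [true] the second bit is replaced by a copy of the first;
    this correlates the two bits exactly as in [corr_weight t]. *)
Definition recopy (v : bool * bool * bool) : bool * bool :=
  (v.1.1, if v.2 then v.1.1 else v.1.2).

Lemma sum_bool3 (F : bool * bool * bool -> R) :
  \sum_v F v = \sum_v (F (v, true) + F (v, false)).
Proof.
transitivity (\sum_v F (v.1, v.2)); first by apply: eq_bigr => -[].
rewrite -(pair_bigA _ (fun a b => F (a, b)))/=.
by apply: eq_bigr => v _; rewrite big_bool.
Qed.

Lemma atoms_independent (Q : probability (joint R p) R) t :
  has_atoms Q (corr_weight 0) corner ->
  has_atoms Q (coupling_weight t) (fun v => corner v.1).
Proof.
move=> HQ A mA; rewrite HQ//; congr EFin; rewrite sum_bool3.
apply: eq_bigr => v _; rewrite /corr_weight /coupling_weight /=; ring.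
Qed.

Lemma atoms_recopy (P : probability (joint R p) R) t :
  has_atoms P (corr_weight t) corner ->
  has_atoms P (coupling_weight t) (fun v => corner (recopy v)).
Proof.
move=> HP A mA; rewrite HP//; congr EFin; rewrite sum_bool3 !sum_bool2.
rewrite /corr_weight /coupling_weight /sgn /recopy/=.
by field.
Qed.

Lemma coupling_weight_ge0 t v : 0 <= t <= 1 / 4 -> 0 <= coupling_weight t v.
Proof. by move=> t01; rewrite /coupling_weight; case: ifP => _; lra. Qed.

Lemma sum_coupling_weight t : \sum_v coupling_weight t v = 1.
Proof. by rewrite sum_bool3 sum_bool2 /coupling_weight/=; lra. Qed.

(** The corners can differ only when the coin shows [true]. *)
Lemma coupling_disagreement t : 0 <= t <= 1 / 4 ->
  \sum_v coupling_weight t v * (corner v.1 != corner (recopy v))%:R <= 4 * t.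
Proof.
move=> t01.
apply: (@le_trans _ _ (\sum_v coupling_weight t v * (v.2)%:R)).
  apply: ler_sum => -[[a b] [|]] _; rewrite ler_wpM2l ?coupling_weight_ge0//=.
    by case: eqP.
  by rewrite /recopy/= eqxx.
by rewrite sum_bool3 sum_bool2 /coupling_weight/=; lra.
Qed.

End corr_coupling.

(** * Lower bounds on the separation *)

Lemma ln_onediv_gt0 (R : realType) (s : R) : 0 < s < 1 -> 0 < ln (1 / s).
Proof.
by move=> /andP[s0 s1]; rewrite ln_gt0// ltr_pdivlMr// mul1r.
Qed.

(** The value for which the factor [1/2] lost in the affinity bound is paid for by
    lowering the exponent: [32 * exponent_slack c = 1 - ln 2 / ln (1 / c)]. It is
    positive exactly because [c < 1/2]. *)
Definition exponent_slack (R : realType) (c : R) : R := (1 - ln 2 / ln (1 / c)) / 32.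

Lemma exponent_slack_itv (R : realType) (c : R) :
  0 < c < 1 / 2 -> 0 < exponent_slack c < 1 / 32.
Proof.
move=> c01; have c1 : 0 < c < 1 by lra.
have L0 := ln_onediv_gt0 c1.
have l2 : 0 < ln 2 :> R by rewrite ln_gt0//; lra.
have lt2 : ln 2 < ln (1 / c).
  rewrite ltr_ln ?posrE//; first by rewrite ltr_pdivlMr; lra.
  by rewrite divr_gt0//; lra.
have : 0 < ln 2 / ln (1 / c) by exact: divr_gt0.
have : ln 2 / ln (1 / c) < 1 by rewrite ltr_pdivrMr// [ltRHS]mul1r.
rewrite /exponent_slack; lra.
Qed.

(** In logarithms, with [L = ln (1 / s)] and [L1 = ln (1 / c)], the claim is
    [ln 2 < ln 2 * L / L1], which holds since [s < c]. *)
Lemma exponent_slack_spec (R : realType) (c s : R) : 0 < c < 1 / 2 -> 0 < s < c ->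
  s < expR (- (32 * exponent_slack c * ln (1 / s))) / 2.
Proof.
move=> c01 sc; have c1 : 0 < c < 1 by lra.
have L0 := ln_onediv_gt0 c1.
have s0 : 0 < s by lra.
have l2 : 0 < ln 2 :> R by rewrite ln_gt0//; lra.
have lt : ln (1 / c) < ln (1 / s).
  rewrite ltr_ln ?posrE ?divr_gt0//; [|lra].
  by rewrite !div1r ltf_pV2 ?posrE//; lra.
rewrite ltr_pdivlMr// -ltr_ln ?posrE ?expR_gt0 ?mulr_gt0// expRK lnM ?posrE//.
have -> : ln s = - ln (1 / s) by rewrite div1r lnV ?posrE// opprK.
have -> : 32 * exponent_slack c = 1 - ln 2 / ln (1 / c).
  by rewrite /exponent_slack; field; rewrite gt_eqF.
set L := ln (1 / s) in lt *; set L1 := ln (1 / c) in L0 lt *.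
suff : ln 2 < ln 2 / L1 * L by lra.
have LL1 : 1 < L / L1 by rewrite ltr_pdivlMr// mul1r.
have -> : ln 2 / L1 * L = ln 2 * (L / L1) by ring.
by rewrite ltr_pMr.
Qed.

Lemma xi_gt0 (R : realType) (eps delta : R) : 0 < eps -> 0 <= delta < 1 ->
  0 < xi eps delta.
Proof.
move=> e0 d01; rewrite /xi ltr_wpDr// ln_ge0// ler_pdivlMr; lra.
Qed.

Section separation.
Context (R : realType) (d : nat) (p : 'I_d -> nat).
Context (k : forall j, 'rV[R]_(p j) -> 'rV[R]_(p j) -> R).
Context (kappa : forall j, 'rV[R]_(p j) -> R) (eta : 'I_d -> R).
Context (x0 : forall j, 'rV[R]_(p j)) (j0 j1 : 'I_d).
Context (H : function_hilbert R (joint R p)) (alpha beta eps delta rho : R) (n : nat).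
Arguments k : clear implicits.
Arguments kappa : clear implicits.
Context (j01 : j1 != j0).
Context (eta0 : forall j, 0 < eta j).
Context (psd_k : forall j, psd_kernel (k j)).
Context (kE : forall j x x', k j x x' = kappa j (x - x')).
Context (kappa_gap : forall j, eta j <= kappa j 0 - kappa j (x0 j)).
Context (kc : forall j, continuous (fun z : 'rV[R]_(p j) * 'rV[R]_(p j) => k j z.1 z.2)).
Context (rkhsH : is_rkhs (tensor_kernel k) H).
Context (minimax_rho : (minimax_type2 n (@independent_coords R d p)
  (dHSIC_alternatives H rho) alpha eps delta <= beta%:E)%E).

(** If [rho] were below the dHSIC of the law at [t], that law would be an
    alternative, and the two-point bound would push the minimax error above
    [beta]. *)
Lemma separation_of_risk (t s : R) : 0 <= t <= 1 / 4 -> alpha + beta < s ->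
  (forall (P0 P1 : probability (joint R p) R) (phi : test R (joint R p) n),
    has_atoms P0 (corr_weight 0) (corner j0 j1 x0) ->
    has_atoms P1 (corr_weight t) (corner j0 j1 x0) ->
    dp eps delta phi -> (s%:E <=
    test_expectation P0 phi (fun b => b%:R)%R +
    test_expectation P1 phi (fun b => 1 - b%:R)%R)%E) ->
  t * Num.sqrt (gap_product eta j0 j1) <= rho.
Proof.
move=> t01 abs risk; rewrite leNgt; apply/negP => rho_lt.
have t0 : 0 <= (0 : R) <= 1 / 4 by lra.
have [P0 P0E] := atoms_exist (corner j0 j1 x0)
  (fun v => corr_weight_ge0 v t0) (sum_corr_weight 0).
have [P1 P1E] := atoms_exist (corner j0 j1 x0)
  (fun v => corr_weight_ge0 v t01) (sum_corr_weight t).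
have ind : independent_coords P0.
  by move=> A mA; exact: (product_of_marginals_corr j01 P0E P0E).
have alt : dHSIC_alternatives H rho P1.
  apply: le_trans (corr_dHSIC j01 eta0 psd_k kE kappa_gap kc rkhsH t01 P1E P0E).
  by rewrite lee_fin ltW.
have := le_trans (le_cam_minimax alpha ind alt (fun phi => risk P0 P1 phi P0E P1E))
  minimax_rho.
rewrite lee_fin; lra.
Qed.

(** The choice is [t^2 = exponent_slack c * m^2], with [m] the minimum in the
    statement; capping [m] at [1] keeps [t] below [1 / 4]. *)
Lemma separation_nonprivate (c : R) : 0 < c < 1 / 2 -> 0 < alpha + beta < c ->
  (0 < n)%N ->
  Num.sqrt (gap_product eta j0 j1) * Num.sqrt (exponent_slack c) *
    Num.min (Num.sqrt (ln (1 / (alpha + beta)) / n%:R)) 1 <= rho.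
Proof.
move=> c01 sc n0; set s := alpha + beta in sc *; set m := Num.min _ _.
have r01 := exponent_slack_itv c01; have n0' : 0 < n%:R :> R by rewrite ltr0n.
have L0 : 0 < ln (1 / s) by apply: ln_onediv_gt0; lra.
pose t := Num.sqrt (exponent_slack c) * m.
have m0 : 0 <= m by rewrite le_min sqrtr_ge0 ler01.
have m1 : m <= 1 by rewrite ge_min lexx orbT.
have mL : m ^+ 2 <= ln (1 / s) / n%:R.
  rewrite -[leRHS]sqr_sqrtr ?divr_ge0 ?(ltW L0) ?(ltW n0')//.
  by rewrite lerXn2r ?nnegrE ?sqrtr_ge0// ge_min lexx.
have tE : t ^+ 2 = exponent_slack c * m ^+ 2.
  by rewrite exprMn sqr_sqrtr//; lra.
have t0 : 0 <= t by rewrite mulr_ge0 ?sqrtr_ge0.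
have t2 : t ^+ 2 <= 1 / 32.
  rewrite tE; have : m ^+ 2 <= 1 by rewrite expr_le1. nra.
have t01 : 0 <= t <= 1 / 4.
  rewrite t0 -(@ler_pXn2r _ 2)// ?nnegrE//; lra.
have -> : Num.sqrt (gap_product eta j0 j1) * Num.sqrt (exponent_slack c) * m =
    t * Num.sqrt (gap_product eta j0 j1) by rewrite /t; ring.
apply: (separation_of_risk t01 (exponent_slack_spec c01 sc)) => P0 P1 phi P0E P1E pdp.
have t00 : 0 <= (0 : R) <= 1 / 4 by lra.
apply: le_trans (risk_affinity phi (fun v => corr_weight_ge0 v t00)
  (fun v => corr_weight_ge0 v t01) (sum_corr_weight 0) (sum_corr_weight t) P0E P1E).
rewrite lee_fin ler_pM2r// -exprM.
have x12 : 0 <= 8 * t ^+ 2 <= 1 / 2 by have := sqr_ge0 t; lra.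
apply: (@le_trans _ _ (expR (- (2 * (8 * t ^+ 2))) ^+ (n * 2))); last first.
  rewrite lerXn2r ?nnegrE ?expR_ge0 ?sumr_ge0//.
  exact: le_trans (expR_le_onem x12) (corr_affinity t01).
rewrite -expRM_natl ler_expR natrM.
have : t ^+ 2 * n%:R <= exponent_slack c * ln (1 / s).
  rewrite tE -mulrA; apply: ler_wpM2l; first lra.
  by rewrite -ler_pdivlMr.
lra.
Qed.

(** With [t = m / 8] the coupled samples differ at [4 n t] places on average,
    hence the total error stays above [1 - 4 n t * xi >= 1 / 2]. *)
Lemma separation_private : alpha + beta < 1 / 2 -> 0 < eps -> 0 <= delta < 1 ->
  (0 < n)%N ->
  Num.sqrt (gap_product eta j0 j1) * (1 / 8) *
    Num.min (1 / (n%:R * xi eps delta)) 1 <= rho.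
Proof.
move=> s12 e0 d01 n0; set m := Num.min _ _.
have n0' : 0 < n%:R :> R by rewrite ltr0n.
have x0' := xi_gt0 e0 d01.
have nx : 0 < n%:R * xi eps delta by rewrite mulr_gt0.
have m0 : 0 <= m by rewrite le_min ler01 divr_ge0// ltW.
have m1 : m <= 1 by rewrite ge_min lexx orbT.
have mx : m * (n%:R * xi eps delta) <= 1.
  by rewrite -ler_pdivlMr// ge_min lexx.
pose t := m / 8.
have -> : Num.sqrt (gap_product eta j0 j1) * (1 / 8) * m =
    t * Num.sqrt (gap_product eta j0 j1) by rewrite /t; field.
have t01 : 0 <= t <= 1 / 4 by rewrite /t; lra.
apply: (separation_of_risk t01 s12) => P0 P1 phi P0E P1E pdp.
apply: le_trans (risk_coupling (fun v => coupling_weight_ge0 v t01)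
  (sum_coupling_weight t) (atoms_independent t P0E) (atoms_recopy P1E)
  (ltW e0) d01 pdp).
rewrite lee_fin.
have := coupling_disagreement j0 j1 x0 t01; set S := \sum_v _ => S4.
have : xi eps delta * (n%:R * S) <= xi eps delta * (n%:R * (4 * t)).
  by rewrite !ler_pM2l.
rewrite /t; lra.
Qed.

End separation.

Theorem theorem4p2 (R : realType) (c : R) (hc : c < 1 / 2)
    (d : nat) (hd : (2 <= d)%N)
    (eta : 'I_d -> R) (heta : forall j, 0 < eta j) :
  exists2 C : R, 0 < C &
  forall (p : 'I_d -> nat)
    (k : forall j : 'I_d, 'rV[R]_(p j) -> 'rV[R]_(p j) -> R)
    (H : function_hilbert R (joint R p))
    (kappa : forall j : 'I_d, 'rV[R]_(p j) -> R)
    (alpha beta eps delta : R) (n : nat),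
  (forall j, continuous
     (fun z : 'rV[R]_(p j) * 'rV[R]_(p j) => k j z.1 z.2)) ->
  (forall j, bounded_kernel (k j)) ->
  (forall j, psd_kernel (k j)) ->
  is_rkhs (tensor_kernel k) H ->
  characteristic (tensor_kernel k) ->
  (forall j x x', k j x x' = kappa j (x - x')) ->
  (forall j, exists x0 : 'rV[R]_(p j), eta j <= kappa j 0 - kappa j x0) ->
  0 < alpha -> 0 < beta -> alpha + beta < c ->
  0 < eps -> 0 <= delta -> delta < 1 ->
  (0 < n)%N ->
  ((C * Num.max
      (Num.min (Num.sqrt (ln (1 / (alpha + beta)) / n%:R)) 1)
      (Num.min (1 / (n%:R * xi eps delta)) 1))%:E
    <= rho_dHSIC H alpha beta eps delta n)%E.
Proof.
pose j0 : 'I_d := Ordinal (ltnW hd); pose j1 : 'I_d := Ordinal hd.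
have j01 : j1 != j0 by [].
set G := Num.sqrt (gap_product eta j0 j1).
have G0 : 0 < G by rewrite sqrtr_gt0 gap_product_gt0.
(* For [c <= 0] the conditions on [alpha] and [beta] are contradictory. *)
have [c0|c0] := leP c 0.
  exists 1 => // p k H kappa alpha beta eps delta n _ _ _ _ _ _ _ a0 b0 ab.
  by exfalso; lra.
have c01 : 0 < c < 1 / 2 by rewrite c0 hc.
have r0 : 0 < Num.sqrt (exponent_slack c).
  by rewrite sqrtr_gt0; have := exponent_slack_itv c01; lra.
exists (G * Num.min (Num.sqrt (exponent_slack c)) (1 / 8)).
  by rewrite mulr_gt0// lt_min r0 divr_gt0.
move=> p k H kappa alpha beta eps delta n kc _ psd_k rH _ kE hx0 a0 b0 ab e0 d0 d1 n0.
have [x0 gap] : exists x0 : forall j, 'rV[R]_(p j),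
    forall j, eta j <= kappa j 0 - kappa j (x0 j).
  by exists (fun j => sval (cid (hx0 j))) => j; exact: svalP (cid (hx0 j)).
apply/ereal_infP => _ [rho [rho0 minimax_rho] <-]; rewrite lee_fin.
have s01 : 0 < alpha + beta < c by lra.
have d01 : 0 <= delta < 1 by rewrite d0.
have s12 : alpha + beta < 1 / 2 by lra.
have np := separation_nonprivate j01 heta psd_k kE gap kc rH minimax_rho c01 s01 n0.
have pr := separation_private j01 heta psd_k kE gap kc rH minimax_rho s12 e0 d01 n0.
have xi0 := xi_gt0 e0 d01.
rewrite maxr_pMr; last by rewrite mulr_ge0 ?(ltW G0)// le_min (ltW r0) divr_ge0.
rewrite ge_max; apply/andP; split.
  apply: le_trans np; rewrite -/G; apply: ler_wpM2r.
    by rewrite le_min sqrtr_ge0 ler01.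
  by rewrite ler_pM2l// ge_min lexx.
apply: le_trans pr; rewrite -/G; apply: ler_wpM2r.
  by rewrite le_min ler01 divr_ge0// mulr_ge0// ltW.
by rewrite ler_pM2l// ge_min lexx orbT.
Qed.
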